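(* Let $((\mathfrak{g}\oplus\mathfrak{g}^{*},P+Q^{*}),(\mathfrak{g},P),(\mathfrak{g}^{*}, Q^{*}))$ be a Manin triple of Rota-Baxter Lie algebras of weight zero. Then the induced pre-Lie algebras from the three Rota-Baxter Lie algebras, namely $(\mathfrak g\oplus\mathfrak g^*,\circ)$ with $u\circ v=[(P+Q^* )(u),v]$, $(\mathfrak g,\circ_{\mathfrak g})$ with $x\circ_{\mathfrak g}y=[P(x),y]_{\mathfrak g}$, and $(\mathfrak g^*,\circ_{\mathfrak g^*})$ with $a^*\circ_{\mathfrak g^*}b^*=[Q^*(a^* ),b^*]_{\mathfrak g^*}$, form a Manin triple $((\mathfrak g\bowtie\mathfrak g^*,\circ), (\mathfrak g,\circ_{\mathfrak g}),(\mathfrak g^*,\circ_{\mathfrak g^*}))$ of pre-Lie algebras with respect to the nondegenerate symmetric left-invariant bilinear form $\mathcal{B}_{d}$ associated to $(\mathfrak g,\circ_{\mathfrak g})$ and $(\mathfrak g^{*},\circ_{\mathfrak g^{*}})$.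
   Context: All vector spaces and algebras are finite-dimensional over a field of characteristic zero. A Rota-Baxter Lie algebra of weight zero is $(\mathfrak{g},[-,-],P)$ with $(\mathfrak g,[-,-])$ a Lie algebra and $P$ linear with $[P(x),P(y)]=P([x,P(y)])+P([P(x),y])$; it induces the pre-Lie algebra $(\mathfrak{g},\circ)$, $x\circ y=[P(x),y]$. A pre-Lie algebra is $(A,\circ)$ with $(x\circ y)\circ z-x\circ(y\circ z)=(y\circ x)\circ z-y\circ(x\circ z)$. On $A\oplus A^*$ let $\mathcal{B}_{d}(x+a^{*},y+b^{*})=\langle x,b^{*}\rangle+\langle a^{*},y\rangle$. A Manin triple of Rota-Baxter Lie algebras $((\mathfrak{g}\oplus\mathfrak{g}^{*},P+Q^{*}),(\mathfrak{g},P),(\mathfrak{g}^{*},Q^{*}))$ of weight zero: $(\mathfrak{g},[-,-]_{\mathfrak g},P)$, $(\mathfrak{g}^*,[-,-]_{\mathfrak g^*},Q^* )$ and $(\mathfrak{g}\oplus\mathfrak{g}^*,[-,-],P+Q^* )$ are Rota-Baxter Lie algebras of weight zero, where $Q^*$ is the transpose of a linear map $Q:\mathfrak g\to\mathfrak g$ and $(P+Q^* )(x+a^* )=P(x)+Q^*(a^* )$; $\mathfrak{g}$ and $\mathfrak{g}^*$ are Lie subalgebras of $\mathfrak{g}\oplus\mathfrak{g}^*$; and $\mathcal{B}_d$ is invariant, $\mathcal{B}_d([u,v],w)=\mathcal{B}_d(u,[v,w])$. A bilinear form $\mathcal{B}$ on a pre-Lie algebra is left-invariant if $\mathcal{B}(x\circ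 y,z)+\mathcal{B}(y,x\circ z)=0$ for all $x,y,z$. A Manin triple of pre-Lie algebras with respect to $\mathcal{B}_d$ associated to $(A,\circ_A)$ and $(A^*,\circ_{A^*})$ is a triple $((A\oplus A^*,\circ),(A,\circ_A),(A^*,\circ_{A^*}))$ of pre-Lie algebras such that $(A,\circ_A)$ and $(A^*,\circ_{A^*})$ are pre-Lie subalgebras of $(A\oplus A^*,\circ)$ and $\mathcal{B}_d$ is left-invariant on $(A\oplus A^*,\circ)$; the pre-Lie algebra on $A\oplus A^*$ is then denoted $A\bowtie A^*$. *)

(* Defs.v *)
From HB Require Import structures.
From mathcomp Require Import all_boot all_order all_algebra.

Set Implicit Arguments.
Unset Strict Implicit.
Unset Printing Implicit Defensive.

Import GRing.Theory.
Local Open Scope ring_scope.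

Notation dual_space A := 'Hom(A, _^o).

Section Algebras.
Variables (K : fieldType) (A : vectType K).
Implicit Types (mul : A -> A -> A) (P : 'End(A)) (B : A -> A -> K).

Record lie_algebra mul : Prop := LieAlgebra {
  lie_bilinear : bilinear_for *:%R *:%R mul;
  lie_alternating : forall x, mul x x = 0;
  lie_jacobi : forall x y z,
    mul x (mul y z) + mul y (mul z x) + mul z (mul x y) = 0 }.

Record prelie_algebra mul : Prop := PreLieAlgebra {
  prelie_bilinear : bilinear_for *:%R *:%R mul;
  prelie_assoc_sym : forall x y z,
    mul (mul x y) z - mul x (mul y z) = mul (mul y x) z - mul y (mul x z) }.

(* Rota-Baxter Lie algebras and operators are always of weight zero here. *)
Record rota_baxter_lie mul P : Prop := RotaBaxterLie {
  rota_baxter_is_lie : lie_algebra mul;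
  rota_baxter_eq : forall x y,
    mul (P x) (P y) = P (mul x (P y)) + P (mul (P x) y) }.

Definition induced_prelie mul P : A -> A -> A := fun x y => mul (P x) y.

Definition invariant_biform mul B := forall x y z,
  B (mul x y) z = B x (mul y z).

Definition left_invariant_biform mul B := forall x y z,
  B (mul x y) z + B y (mul x z) = 0.

Definition symmetric_biform B := forall x y, B x y = B y x.

(* For a symmetric form on a finite-dimensional space, the left radical is
   the radical. *)
Definition nondegenerate_biform B := forall x, (forall y, B x y = 0) -> x = 0.

End Algebras.

Section Doubles.
Variables (K : fieldType) (A : vectType K).

Definition pairing (x : A) (a : dual_space A) : K := a x.

Definition Bd (u v : A * dual_space A) : K := pairing u.1 v.2 + pairing v.1 u.2.

Definition transpose_fun (Q : 'End(A)) (a : dual_space A) : dual_space A := (a \o Q)%VF.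

Fact transpose_fun_is_linear Q : linear (transpose_fun Q).
Proof. by move=> k a b; rewrite /transpose_fun comp_lfunDl comp_lfunZl. Qed.

HB.instance Definition _ Q :=
  GRing.isLinear.Build K (dual_space A) (dual_space A) *:%R (transpose_fun Q)
    (transpose_fun_is_linear Q).

Definition transpose (Q : 'End(A)) : 'End(dual_space A) := linfun (transpose_fun Q).

Lemma transposeE Q x (a : dual_space A) : pairing x (transpose Q a) = pairing (Q x) a.
Proof. by rewrite /pairing lfunE /= comp_lfunE. Qed.

Variable V : vectType K.

Definition dsum_fun (P : 'End(A)) (R : 'End(V)) (u : A * V) : A * V :=
  (P u.1, R u.2).

Fact dsum_fun_is_linear P R : linear (dsum_fun P R).
Proof. by move=> k u v; rewrite /dsum_fun !linearP. Qed.

HB.instance Definition _ P R :=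
  GRing.isLinear.Build K (A * V)%type (A * V)%type *:%R (dsum_fun P R)
    (dsum_fun_is_linear P R).

Definition dsum (P : 'End(A)) (R : 'End(V)) : 'End((A * V)%type) :=
  linfun (dsum_fun P R).

Lemma dsumE P R (u : A * V) : dsum P R u = (P u.1, R u.2).
Proof. by rewrite lfunE. Qed.

Definition incl (x : A) : A * V := (x, 0).
Definition incr (a : V) : A * V := (0, a).

End Doubles.

Arguments incl {K A V}.
Arguments incr {K A V}.

Section ManinTriples.
Variables (K : fieldType) (A : vectType K).
Variables (mul : A * dual_space A -> A * dual_space A -> A * dual_space A).
Variables (mulA : A -> A -> A) (mulD : dual_space A -> dual_space A -> dual_space A).

Record rota_baxter_manin_triple (P Q : 'End(A)) : Prop := RotaBaxterManinTriple {
  rbmt_double : rota_baxter_lie mul (dsum P (transpose Q));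
  rbmt_left : rota_baxter_lie mulA P;
  rbmt_right : rota_baxter_lie mulD (transpose Q);
  rbmt_incl : {morph incl : x y / mulA x y >-> mul x y};
  rbmt_incr : {morph incr : a b / mulD a b >-> mul a b};
  rbmt_invariant : invariant_biform mul (@Bd K A) }.

Record prelie_manin_triple : Prop := PreLieManinTriple {
  plmt_double : prelie_algebra mul;
  plmt_left : prelie_algebra mulA;
  plmt_right : prelie_algebra mulD;
  plmt_incl : {morph incl : x y / mulA x y >-> mul x y};
  plmt_incr : {morph incr : a b / mulD a b >-> mul a b};
  plmt_left_invariant : left_invariant_biform mul (@Bd K A) }.

End ManinTriples.

(* Main.v *)
(* Put R = P + Q^*.  The Rota-Baxter identity turns [R(u o v) - R(v o u)] into
   [[R u, R v]], so pre-Lie symmetry of [u o v = [R u, v]] is the Jacobi identity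
   for [R u], [R v], w.  Invariance of Bd makes every [ad (R u)] skew-adjoint,
   which is left-invariance. *)
Require Import Defs.
From mathcomp Require Import all_boot all_order all_algebra.
Set Implicit Arguments.
Unset Strict Implicit.
Unset Printing Implicit Defensive.
Import GRing.Theory.
Local Open Scope ring_scope.

Section InducedPreLie.
Variables (K : fieldType) (A : vectType K) (mul : A -> A -> A).
Hypothesis lie_mul : lie_algebra mul.

Lemma lie_mulDl x y z : mul (x + y) z = mul x z + mul y z.
Proof.
by have [bil _] := lie_bilinear lie_mul; have := bil z 1 x y; rewrite /= !scale1r.
Qed.

Lemma lie_mulDr x y z : mul x (y + z) = mul x y + mul x z.
Proof.
by have [_ bil] := lie_bilinear lie_mul; have := bil x 1 y z; rewrite /= !scale1r.
Qed.

Lemma lie_mul0r x : mul x 0 = 0.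
Proof. by apply: (addrI (mul x 0)); rewrite -lie_mulDr !addr0. Qed.

Lemma lie_mulNr x y : mul x (- y) = - mul x y.
Proof. by apply/eqP; rewrite -addr_eq0 -lie_mulDr addNr lie_mul0r. Qed.

(** Polarisation: expand the vanishing square of [x + y]. *)
Lemma lie_mulC x y : mul x y = - mul y x.
Proof.
apply/eqP; rewrite -addr_eq0.
have := lie_alternating lie_mul (x + y).
by rewrite lie_mulDl !lie_mulDr !(lie_alternating lie_mul) add0r addr0 => ->.
Qed.

(** Jacobi with two brackets flipped by antisymmetry; it expresses that [ad] is a representation. *)
Lemma lie_leibniz x y z : mul (mul x y) z = mul x (mul y z) - mul y (mul x z).
Proof.
have := lie_jacobi lie_mul x y z.
rewrite (lie_mulC z (mul x y)) (lie_mulC z x) lie_mulNr => /eqP.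
by rewrite subr_eq0 => /eqP <-.
Qed.

Lemma induced_prelieP (P : 'End(A)) :
  rota_baxter_lie mul P -> prelie_algebra (induced_prelie mul P).
Proof.
case=> _ rb; have [bill bilr] := lie_bilinear lie_mul.
split; first by split=> [z k x y|z k x y]; rewrite /induced_prelie ?linearP ?bill ?bilr.
move=> x y z; rewrite /induced_prelie.
(* The Rota-Baxter identity is solved for [P (mul (P x) y)], with antisymmetry turning
   [P (mul x (P y))] into [- P (mul (P y) x)]. *)
have comm : mul (P (mul (P x) y)) z
    = mul (mul (P x) (P y)) z + mul (P (mul (P y) x)) z.
  by rewrite -lie_mulDl rb (lie_mulC x) linearN addrAC addNr add0r.
by apply/eqP; rewrite comm lie_leibniz subr_eq -addrA addrC [- _ + _]addrC.
Qed.

Lemma induced_prelie_left_invariant (P : 'End(A)) (B : A -> A -> K) :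
  (forall x y, B (- x) y = - B x y) ->
  invariant_biform mul B -> left_invariant_biform (induced_prelie mul P) B.
Proof.
by move=> BN inv x y z; rewrite /induced_prelie lie_mulC BN inv addNr.
Qed.

End InducedPreLie.

(** Meant for [f] equal to [incl] and [incr], so that both summands become pre-Lie subalgebras of
    the double. *)
Lemma induced_prelie_morph (K : fieldType) (A V : vectType K)
    (mul : A -> A -> A) (mul' : V -> V -> V) (P : 'End(A)) (R : 'End(V)) (f : A -> V) :
  {morph f : x y / mul x y >-> mul' x y} -> (forall x, f (P x) = R (f x)) ->
  {morph f : x y / induced_prelie mul P x y >-> induced_prelie mul' R x y}.
Proof. by move=> fM fP x y; rewrite /induced_prelie fM fP. Qed.

Section DualPairing.
Variables (K : fieldType) (A : vectType K).

Lemma pairing_separates (x : A) : (forall a : dual_space A, pairing x a = 0) -> x = 0.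
Proof.
move=> x0; rewrite (coord_vbasis (memvf x)) big1 // => i _.
(* Testing against the coordinate functionals of a basis kills every coordinate of [x]. *)
have := x0 (linfun (coord (vbasis fullv) i : A -> K^o)).
by rewrite /pairing lfunE /= => ->; rewrite scale0r.
Qed.

Lemma Bd_symmetric : symmetric_biform (@Bd K A).
Proof. by move=> u v; rewrite /Bd addrC. Qed.

Lemma Bd_bilinear : bilinear_for *%R *%R (@Bd K A).
Proof.
have linl v : linear_for *%R (@Bd K A ^~ v).
  move=> k u w; rewrite /Bd /pairing /= linearP add_lfunE scale_lfunE.
  by rewrite mulrDr addrACA.
(* Symmetry transfers linearity to the other argument. *)
by split=> // u k v w; rewrite !(Bd_symmetric u) linl.
Qed.

Lemma Bd_nondegenerate : nondegenerate_biform (@Bd K A).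
Proof.
move=> [x a] B0; congr pair.
  (* Vectors [(0, b)] detect the component [x]; vectors [(y, 0)] then detect [a] as a functional. *)
  apply: pairing_separates => b.
  by have := B0 (0, b); rewrite /Bd /pairing /= linear0 addr0.
apply/lfunP => y; have := B0 (y, 0).
by rewrite /Bd /pairing /= !zero_lfunE add0r.
Qed.

Lemma BdNl u v : @Bd K A (- u) v = - Bd u v.
Proof. by rewrite /Bd /pairing /= linearN opp_lfunE opprD. Qed.

End DualPairing.

Theorem corollary3p13 (K : fieldType) (charK0 : [pchar K] =i pred0)
    (g : vectType K) (P Q : 'End(g))
    (br : g * dual_space g -> g * dual_space g -> g * dual_space g)
    (br_g : g -> g -> g) (br_d : dual_space g -> dual_space g -> dual_space g)
    (manin : rota_baxter_manin_triple br br_g br_d P Q) :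
  [/\ prelie_manin_triple
        (induced_prelie br (dsum P (transpose Q)))
        (induced_prelie br_g P)
        (induced_prelie br_d (transpose Q)),
      bilinear_for *%R *%R (@Bd K g),
      symmetric_biform (@Bd K g)
    & nondegenerate_biform (@Bd K g)].
Proof.
have [rb rb_g rb_d incl_br incr_br inv] := manin.
split; [split | exact: Bd_bilinear | exact: Bd_symmetric | exact: Bd_nondegenerate].
- exact: (induced_prelieP (rota_baxter_is_lie rb) rb).
- exact: (induced_prelieP (rota_baxter_is_lie rb_g) rb_g).
- exact: (induced_prelieP (rota_baxter_is_lie rb_d) rb_d).
(* Each inclusion intertwines the operators, since the other component of the double's operator
   sends 0 to 0. *)
- by apply: induced_prelie_morph => // x; rewrite dsumE linear0.
- by apply: induced_prelie_morph => // a; rewrite dsumE linear0.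
- exact: (induced_prelie_left_invariant (rota_baxter_is_lie rb) _ (@BdNl _ _) inv).
Qed.
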